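(* Let $k\in\mathbb C$, $k\ne0,-1$, and $p,l,a\in\mathbb C$. In the realization of the affine $s\ell(2|1)$ currents of level $k$ in terms of an $N=2$ superconformal algebra with central charge $\mathsf c=-3-6k$ and the free fields $\partial F,\partial U,\psi,\bar\psi$ (see context), the state $$|k-2p,\,l,\,k\rangle_{N=2}\otimes|e^{a(U-F)}\rangle\otimes|0\rangle_{\psi\bar\psi}$$ satisfies the Ramond-sector $s\ell(2|1)$ highest-weight conditions with parameters $(p,j,k)$, where $j=ka/2$, if and only if $$l=-\frac{(j+p-\frac k2)(1-j+\frac k2+p)}{1+k}.$$
   Context: $N=2$ algebra (twisted form): generators $\mathcal L_n,\mathcal H_n$ (even), $\mathcal G_n,\mathcal Q_n$ (odd), $n\in\mathbb Z$, with $[\mathcal L_m,\mathcal L_n]=(m-n)\mathcal L_{m+n}$, $[\mathcal H_m,\mathcal H_n]=\frac{\mathsf c}3m\delta_{m+n,0}$, $[\mathcal L_m,\mathcal G_n]=(m-n)\mathcal G_{m+n}$, $[\mathcal H_m,\mathcal G_n]=\mathcal G_{m+n}$, $[\mathcal L_m,\mathcal Q_n]=-n\mathcal Q_{m+n}$, $[\mathcal H_m,\mathcal Q_n]=-\mathcal Q_{m+n}$, $[\mathcal L_m,\mathcal H_n]=-n\mathcal H_{m+n}+\frac{\mathsf c}6(m^2+m)\delta_{m+n,0}$, $\{\mathcal G_m,\mathcal Q_n\}=2\mathcal L_{m+n}-2n\mathcal H_{m+n}+\frac{\mathsf c}3(m^2+m)\delta_{m+n,0}$. Fields: $\mathcal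 T(z)=\sum\mathcal L_nz^{-n-2}$, $\mathcal G(z)=\sum\mathcal G_nz^{-n-2}$, $\mathcal Q(z)=\sum\mathcal Q_nz^{-n-1}$, $\mathcal H(z)=\sum\mathcal H_nz^{-n-1}$ (sums over $\mathbb Z$). The vector $|h,\ell,k\rangle_{N=2}$ ($\mathsf c=-3-6k$) is the highest-weight vector of the $N=2$ Verma module: annihilated by $\mathcal Q_{\ge1},\mathcal G_{\ge0},\mathcal L_{\ge1},\mathcal H_{\ge1}$, with $\mathcal H_0=h$, $\mathcal L_0=\ell$ on it; the module is freely generated by the remaining modes. Free fields: $\partial F(z)\partial F(w)\sim\frac{-k/2}{(z-w)^2}$, $\partial U(z)\partial U(w)\sim\frac{k/2}{(z-w)^2}$, $\psi(z)\bar\psi(w)\sim\frac1{z-w}$, all other products among them and with the $N=2$ fields being trivial ($\psi,\bar\psi$ anticommute with $\mathcal G,\mathcal Q$). $|e^{a(U-F)}\rangle$ is the Fock vacuum created by the vertex operator $e^{a(U-F)}$: annihilated by the positive modes of $\partial F,\partial U$, with zero modes $(\partial U)_0=(\partial F)_0=ka/2$; vertex operators $e^{b(U-F)}(z)$ act between these Fock modules, shifting $a\to a+b$. $\psi(z)=\sum_{n\in\mathbb Z}\psi_nz^{-n}$, $\bar\psi(z)=\sum_{n\in\mathbb Z}\bar\psi_nz^{-n-1}$, and $\psi_{\ge1}|0\rangle_{\psi\bar\psi}=\bar\psi_{\ge0}|0\rangle_{\psi\bar\psi}=0$. Realization of the $s\ell(2|1)$ currents $C(z)=\sum_{n\in\mathbb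 Z}C_nz^{-n-1}$: $E^1=\psi e^{\frac1k(U-F)}$, $E^2=\bar\psi e^{\frac1k(U-F)}$, $E^{12}=e^{\frac2k(U-F)}$, $H^+=-\frac12\mathcal H+\frac12\psi\bar\psi$, $H^-=\partial U$, $F^1=(\mathcal G-\bar\psi\,\partial F-\frac12\mathcal H\bar\psi-(k+\frac12)\partial\bar\psi)e^{-\frac1k(U-F)}$, $F^2=(\frac12(k+1)\mathcal Q+\psi\,\partial F-\frac12\mathcal H\psi+(k+\frac12)\partial\psi)e^{-\frac1k(U-F)}$, $F^{12}=\bigl(-\partial F\,\partial F-(k+1)\partial^2F+(k+1)(\mathcal T+\frac12\partial\mathcal H)+\frac14\mathcal H\mathcal H+\mathcal G\psi-\frac12(k+1)\mathcal Q\bar\psi+\frac12\mathcal H\psi\bar\psi+\frac14(1+2k)\psi\partial\bar\psi-\frac14(1+2k)\partial\psi\,\bar\psi\bigr)e^{-\frac2k(U-F)}$, where every term is multiplied by the vertex operator and normal ordered, nested from right to left as $:\!A:\!BC\!:\,:$. Ramond-sector highest-weight conditions with parameters $(p,j,k)$: annihilation by $E^1_{\ge0},E^2_{\ge0},E^{12}_{\ge0},F^1_{\ge1},F^2_{\ge1},F^{12}_{\ge1},H^\pm_{\ge1}$, and $H^+_0=p-\frac k2$, $H^-_0=j$ on the vector. *)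

(* Defs.v *)
From HB Require Import structures.
From mathcomp Require Import all_boot all_order all_algebra.
From mathcomp Require Import finmap.
From mathcomp Require Import boolp classical_sets fsbigop reals complex.
From mathcomp Require Import xfinmap monalg.

Set Implicit Arguments.
Unset Strict Implicit.
Unset Printing Implicit Defensive.

Import Order.TTheory GRing.Theory Num.Theory.

Local Open Scope fset_scope.
Local Open Scope ring_scope.

(* [{malg V[I]}] carries a module structure in the library only when V is the
   scalar ring; for V : lmodType F the alias [tensor V I] is the F-space
   V (x) F[I], where F[I] has basis I, and [pure u i] is u (x) i. *)
Definition tensor (F : fieldType) (V : lmodType F) (I : choiceType) :=
  {malg V[I]}.

Section Tensor.
Variables (F : fieldType) (V : lmodType F) (I : choiceType).

HB.instance Definition _ := GRing.Zmodule.on (tensor V I).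

Definition pure (u : V) (i : I) : tensor V I := << u *g i >>.

(* The linear extension of u (x) i |-> f u i, for f linear in u. *)
Definition tensor_ext (W : lmodType F) (f : V -> I -> W) (x : tensor V I) : W :=
  \sum_(i <- msupp x) f x@_i i.

Definition tensor_scale (c : F) (x : tensor V I) : tensor V I :=
  \sum_(i <- msupp x) pure (c *: x@_i) i.

Lemma tensor_scaleE c x i : (tensor_scale c x)@_i = c *: x@_i.
Proof.
rewrite /tensor_scale raddf_sum /=.
under eq_bigr => j _ do rewrite /pure mcoeffU.
case: (msuppP x i) => [ix|ix].
  rewrite (big_fsetD1 i) //= eqxx mulr1n big_seq big1 ?addr0 // => j.
  by rewrite in_fsetD1 => /andP[/negPf-> _]; rewrite mulr0n.
rewrite scaler0 big_seq big1 // => j jx.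
by rewrite (_ : j == i = false) //; apply: contraNF ix => /eqP<-.
Qed.

Fact tensor_scaleA a b x :
  tensor_scale a (tensor_scale b x) = tensor_scale (a * b) x.
Proof. by apply/malgP => i; rewrite !tensor_scaleE scalerA. Qed.

Fact tensor_scale1 : left_id 1 tensor_scale.
Proof. by move=> x; apply/malgP => i; rewrite tensor_scaleE scale1r. Qed.

Fact tensor_scaleDr : right_distributive tensor_scale +%R.
Proof.
by move=> a x y; apply/malgP => i; rewrite !(tensor_scaleE, mcoeffD) scalerDr.
Qed.

Fact tensor_scaleDl x : {morph tensor_scale^~ x : a b / a + b}.
Proof.
by move=> a b; apply/malgP => i; rewrite !(tensor_scaleE, mcoeffD) scalerDl.
Qed.

HB.instance Definition _ := GRing.Zmodule_isLmodule.Build F (tensor V I)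
  tensor_scaleA tensor_scale1 tensor_scaleDr tensor_scaleDl.

End Tensor.

Definition comm (V : zmodType) (A B : V -> V) (x : V) : V := A (B x) - B (A x).
Definition acomm (V : zmodType) (A B : V -> V) (x : V) : V := A (B x) + B (A x).

(* A Z/2-graded module over the N = 2 algebra on which the central element acts
   as c; [n2P] is the parity operator, +1 on even and -1 on odd vectors. *)
Record N2_module (F : fieldType) (c : F) (V : lmodType F) := N2Module {
  n2L : int -> {linear V -> V};
  n2H : int -> {linear V -> V};
  n2G : int -> {linear V -> V};
  n2Q : int -> {linear V -> V};
  n2P : {linear V -> V};
  n2_LL : forall m n x,
    comm (n2L m) (n2L n) x = (m - n)%:~R *: n2L (m + n) x;
  n2_HH : forall m n x,
    comm (n2H m) (n2H n) x = (c / 3 * m%:~R * (m + n == 0)%:R) *: x;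
  n2_LG : forall m n x,
    comm (n2L m) (n2G n) x = (m - n)%:~R *: n2G (m + n) x;
  n2_HG : forall m n x, comm (n2H m) (n2G n) x = n2G (m + n) x;
  n2_LQ : forall m n x,
    comm (n2L m) (n2Q n) x = (- n)%:~R *: n2Q (m + n) x;
  n2_HQ : forall m n x, comm (n2H m) (n2Q n) x = - n2Q (m + n) x;
  n2_LH : forall m n x,
    comm (n2L m) (n2H n) x =
      (- n)%:~R *: n2H (m + n) x
      + (c / 6 * (m ^+ 2 + m)%:~R * (m + n == 0)%:R) *: x;
  n2_GQ : forall m n x,
    acomm (n2G m) (n2Q n) x =
      2 *: n2L (m + n) x - (2 * n)%:~R *: n2H (m + n) x
      + (c / 3 * (m ^+ 2 + m)%:~R * (m + n == 0)%:R) *: x;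
  n2_GG : forall m n x, acomm (n2G m) (n2G n) x = 0;
  n2_QQ : forall m n x, acomm (n2Q m) (n2Q n) x = 0;
  n2_PP : forall x, n2P (n2P x) = x;
  n2_PL : forall n x, n2P (n2L n x) = n2L n (n2P x);
  n2_PH : forall n x, n2P (n2H n x) = n2H n (n2P x);
  n2_PG : forall n x, n2P (n2G n x) = - n2G n (n2P x);
  n2_PQ : forall n x, n2P (n2Q n x) = - n2Q n (n2P x)
}.

(* Exponents of the modes L_{-j-1} and H_{-j-1}, and the sets of j such that
   G_{-j-1}, respectively Q_{-j}, occurs. *)
Definition pbw_index : choiceType :=
  ({cmonom nat} * {cmonom nat} * {fset nat} * {fset nat})%type.

Section Verma.
Variables (F : fieldType) (c : F) (V : lmodType F) (M : N2_module c V).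

Definition even_word (A : nat -> V -> V) (m : {cmonom nat}) (x : V) : V :=
  foldr (fun j => iter (m j) (A j)) x (sort leq (finsupp m)).

Definition odd_word (A : nat -> V -> V) (s : {fset nat}) (x : V) : V :=
  foldr A x (sort leq s).

Definition pbw_monomial (v : V) (t : pbw_index) : V :=
  let: (la, mu, s, r) := t in
  even_word (fun j => n2L M (- j%:Z - 1)) la
    (even_word (fun j => n2H M (- j%:Z - 1)) mu
      (odd_word (fun j => n2G M (- j%:Z - 1)) s
        (odd_word (fun j => n2Q M (- j%:Z)) r v))).

(* (V, v) is the Verma module with highest-weight vector v. The last clause
   says that the PBW monomials applied to v form a basis of V. *)
Definition N2_verma (h l : F) (v : V) : Prop :=
  [/\ [/\ forall n : int, 1 <= n -> n2Q M n v = 0,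
          forall n : int, 0 <= n -> n2G M n v = 0,
          forall n : int, 1 <= n -> n2L M n v = 0
        & forall n : int, 1 <= n -> n2H M n v = 0],
      n2H M 0 v = h *: v,
      n2L M 0 v = l *: v,
      n2P M v = v
    & bijective (fun f : {malg F[pbw_index]} =>
                   \sum_(t <- msupp f) f@_t *: pbw_monomial v t)].

End Verma.

(* A field is given by the coefficients A_(n) of A(z) = sum_n A_(n) z^{-n-1},
   whatever its conformal weight, and by its parity. *)
Record superfield (W : Type) := Superfield {
  fmode :> int -> W -> W;
  fodd : bool
}.

Section Fields.
Variables (F : fieldType) (W : lmodType F).

Definition fderiv (A : superfield W) : superfield W :=
  Superfield (fun n x => (- n)%:~R *: A (n - 1) x) (fodd A).

(* :AB:(z) = A(z)_- B(z) + (-1)^{|A||B|} B(z) A(z)_+, where A(z)_- is the part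
   of A(z) with nonnegative powers of z. The sum is finite whenever
   A(z)x and B(z)x have finitely many negative powers of z. *)
Definition nop (A B : superfield W) : superfield W :=
  Superfield (fun n x =>
    \sum_(j \in [set: nat])
      (A (- j%:Z - 1) (B (n + j%:Z) x)
       + (-1) ^+ (fodd A && fodd B) *: B (n - j%:Z - 1) (A j%:Z x)))
    (fodd A (+) fodd B).

(* [pow_coef X r n] and [exp_coef X n] are the coefficients of t^n in the r-th
   power and in the exponential of sum_{j >= 0} X_j t^{j+1}. *)
Fixpoint pow_coef (X : nat -> W -> W) (r n : nat) (x : W) : W :=
  match r with
  | 0 => if n == 0%N then x else 0
  | r'.+1 => \sum_(j < n) X j (pow_coef X r' (n - j.+1) x)
  end.

Definition exp_coef (X : nat -> W -> W) (n : nat) (x : W) : W :=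
  \sum_(r < n.+1) r`!%:R^-1 *: pow_coef X r n x.

End Fields.

Notation "A ** B" := (nop A B) (at level 35, right associativity).

(* Basis of the direct sum over a of the Fock modules of dF, dU, psi, bar psi:
   (a, la, mu, s) stands for
     prod_j dF_{-j-1}^{la j} dU_{-j-1}^{mu j} applied to |e^{a(U-F)}>,
   tensored with the product in increasing order of the fermionic creation
   modes in s acting on the vacuum, where t >= 0 encodes psi_{-t} and t < 0
   encodes bar psi_t. *)
Definition fock_index (F : fieldType) : choiceType :=
  (F * {cmonom nat} * {cmonom nat} * {fset int})%type.

Section Realization.
Variables (F : fieldType) (k : F) (c : F) (V : lmodType F) (M : N2_module c V).

Let W : lmodType F := tensor V (fock_index F).

Definition on_first (A : V -> V) : W -> W :=
  tensor_ext (fun (u : V) (i : fock_index F) => pure (A u) i : W).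

Definition dF_mode (n : int) : W -> W :=
  tensor_ext (fun (u : V) (i : fock_index F) =>
    let: (a, la, mu, s) := i in
    match n with
    | Negz j => pure u (a, mulcm la (ucm j), mu, s)
    | Posz 0 => pure ((k * a / 2) *: u) i
    | Posz j.+1 =>
        pure ((- (k / 2) * (j.+1 * la j)%:R) *: u) (a, divcm la (ucm j), mu, s)
    end : W).

Definition dU_mode (n : int) : W -> W :=
  tensor_ext (fun (u : V) (i : fock_index F) =>
    let: (a, la, mu, s) := i in
    match n with
    | Negz j => pure u (a, la, mulcm mu (ucm j), s)
    | Posz 0 => pure ((k * a / 2) *: u) i
    | Posz j.+1 =>
        pure ((k / 2 * (j.+1 * mu j)%:R) *: u) (a, la, divcm mu (ucm j), s)
    end : W).

Definition fermi_sign (t : int) (s : {fset int}) : F :=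
  (-1) ^+ #|` [fset t' in s | t' < t] |.

(* The parity operator is the sign rule for moving an odd operator past the
   N = 2 factor; it makes psi, bar psi anticommute with G, Q. *)
Definition fermi_create (t : int) : W -> W :=
  tensor_ext (fun (u : V) (i : fock_index F) =>
    let: (a, la, mu, s) := i in
    if t \in s then 0
    else pure (fermi_sign t s *: n2P M u) (a, la, mu, t |` s) : W).

Definition fermi_annihilate (t : int) : W -> W :=
  tensor_ext (fun (u : V) (i : fock_index F) =>
    let: (a, la, mu, s) := i in
    if t \in s then pure (fermi_sign t s *: n2P M u) (a, la, mu, s `\ t)
    else 0 : W).

Definition psi_mode (n : int) : W -> W :=
  if n <= 0 then fermi_create (- n) else fermi_annihilate (- n).

Definition psib_mode (n : int) : W -> W :=
  if n < 0 then fermi_create n else fermi_annihilate n.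

Definition fock_shift (b : F) : W -> W :=
  tensor_ext (fun (u : V) (i : fock_index F) =>
    let: (a, la, mu, s) := i in pure u (a + b, la, mu, s) : W).

(* The weight-2 fields T, G and the weight-0 field psi are reindexed so that
   [fmode _ n] is the coefficient of z^{-n-1}. *)
Definition fT := Superfield (fun n => on_first (n2L M (n - 1))) false.
Definition fH := Superfield (fun n => on_first (n2H M n)) false.
Definition fG := Superfield (fun n => on_first (n2G M (n - 1))) true.
Definition fQ := Superfield (fun n => on_first (n2Q M n)) true.
Definition fdF := Superfield dF_mode false.
Definition fdU := Superfield dU_mode false.
Definition fpsi := Superfield (fun n => psi_mode (n + 1)) true.
Definition fpsib := Superfield psib_mode true.

(* With D_n = dU_n - dF_n, e^{b(U-F)}(z) is
     S_b z^{b D_0} exp(b sum_{n>0} D_{-n} z^n / n)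
                   exp(- b sum_{n>0} D_n z^{-n} / n),
   S_b being the shift a |-> a + b. Here D_0 = 0 on every Fock module, since
   dU_0 = dF_0 = ka/2, so that the factor z^{b D_0} is 1. *)
Definition vertex (b : F) : superfield W :=
  let D n x := dU_mode n x - dF_mode n x in
  let creat := exp_coef (fun j x => (b / j.+1%:R) *: D (- j.+1%:Z) x) in
  let annih := exp_coef (fun j x => - (b / j.+1%:R) *: D j.+1%:Z x) in
  Superfield (fun n x =>
    \sum_(ij \in [set ij : nat * nat | ij.1%:Z - ij.2%:Z = - n - 1])
      fock_shift b (creat ij.1 (annih ij.2 x))) false.

End Realization.

Record sl21_currents (W : Type) := Sl21Currents {
  cE1 : int -> W -> W;
  cE2 : int -> W -> W;
  cE12 : int -> W -> W;
  cF1 : int -> W -> W;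
  cF2 : int -> W -> W;
  cF12 : int -> W -> W;
  cHp : int -> W -> W;
  cHm : int -> W -> W
}.

Definition ramond_highest_weight (F : fieldType) (W : lmodType F)
    (J : sl21_currents W) (p j k : F) (x : W) : Prop :=
  [/\ [/\ forall n : int, 0 <= n -> cE1 J n x = 0,
          forall n : int, 0 <= n -> cE2 J n x = 0
        & forall n : int, 0 <= n -> cE12 J n x = 0],
      [/\ forall n : int, 1 <= n -> cF1 J n x = 0,
          forall n : int, 1 <= n -> cF2 J n x = 0
        & forall n : int, 1 <= n -> cF12 J n x = 0],
      forall n : int, 1 <= n -> cHp J n x = 0 /\ cHm J n x = 0,
      cHp J 0 x = (p - k / 2) *: x
    & cHm J 0 x = j *: x].

Section Currents.
Variables (F : fieldType) (k : F) (c : F) (V : lmodType F) (M : N2_module c V).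

Definition N2_sl21_currents : sl21_currents (tensor V (fock_index F)) :=
  let T := fT M in let H := fH M in let G := fG M in let Q := fQ M in
  let dF := fdF k V in let dU := fdU k V in
  let psi := fpsi M in let psib := fpsib M in
  let e b := vertex k V b in
  {| cE1 := psi ** e (1 / k);
     cE2 := psib ** e (1 / k);
     cE12 := e (2 / k);
     cF1 := fun n x =>
       (G ** e (- (1 / k))) n x
       - (psib ** dF ** e (- (1 / k))) n x
       - (1 / 2) *: (H ** psib ** e (- (1 / k))) n x
       - (k + 1 / 2) *: (fderiv psib ** e (- (1 / k))) n x;
     cF2 := fun n x =>
       ((k + 1) / 2) *: (Q ** e (- (1 / k))) n x
       + (psi ** dF ** e (- (1 / k))) n x
       - (1 / 2) *: (H ** psi ** e (- (1 / k))) n x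
       + (k + 1 / 2) *: (fderiv psi ** e (- (1 / k))) n x;
     cF12 := fun n x =>
       - (dF ** dF ** e (- (2 / k))) n x
       - (k + 1) *: (fderiv dF ** e (- (2 / k))) n x
       + (k + 1) *: ((T ** e (- (2 / k))) n x
                     + (1 / 2) *: (fderiv H ** e (- (2 / k))) n x)
       + (1 / 4) *: (H ** H ** e (- (2 / k))) n x
       + (G ** psi ** e (- (2 / k))) n x
       - ((k + 1) / 2) *: (Q ** psib ** e (- (2 / k))) n x
       + (1 / 2) *: (H ** psi ** psib ** e (- (2 / k))) n x
       + ((1 + 2 * k) / 4) *: (psi ** fderiv psib ** e (- (2 / k))) n x
       - ((1 + 2 * k) / 4) *: (fderiv psi ** psib ** e (- (2 / k))) n x;
     cHp := fun n x => - (1 / 2) *: H n x + (1 / 2) *: (psi ** psib) n x;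
     cHm := dU |}.

(* v (x) |e^{a(U-F)}> (x) |0> *)
Definition vacuum_state (v : V) (a : F) : tensor V (fock_index F) :=
  pure v (a, onecm nat, onecm nat, fset0).

End Currents.

(* Main.v *)
Require Import Defs.
From HB Require Import structures.
From mathcomp Require Import all_boot all_order all_algebra.
From mathcomp Require Import finmap.
From mathcomp Require Import classical_sets fsbigop reals complex.
From mathcomp Require Import xfinmap monalg.
From mathcomp Require Import zify ring.

Set Implicit Arguments.
Unset Strict Implicit.
Unset Printing Implicit Defensive.

Import Order.TTheory GRing.Theory Num.Theory.

Local Open Scope ring_scope.

(** Apply a nested normal ordered product :A B: to a vector on which A(z) and
    B(z) have poles of orders d and N. The product then has a pole of order at
    most N + d, and its leading coefficient is that of B applied to that of A.
    A vertex operator has no pole on a state without dF, dU excitations. Hence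
    all conditions hold for degree reasons, or by the choice of h and j, except
    F12_1, to which only the terms dF dF, ddF, T, dH and HH contribute: it acts
    as the shift e^{-2(U-F)/k} times
      - j^2 + (k + 1) j + (k + 1) l - (k + 1) h / 2 + h^2 / 4,  h = k - 2 p. *)

(** * Pure tensors and linear extension *)

Lemma tensor_ext0 (F : fieldType) (V W : lmodType F) (I : choiceType)
  (f : V -> I -> W) : tensor_ext f 0 = 0.
Proof. by rewrite /tensor_ext msupp0 big_seq_fset0. Qed.

(** The support of [pure 0 i] is empty, so the extension gives 0 there; the hypothesis makes [f]
    agree with it in that case. *)
Lemma tensor_ext_pure (F : fieldType) (V W : lmodType F) (I : choiceType)
    (f : V -> I -> W) (u : V) (i : I) :
  f 0 i = 0 -> tensor_ext f (pure u i) = f u i.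
Proof.
move=> f0; rewrite /tensor_ext /pure msuppU; case: eqVneq => [->|_].
  by rewrite big_seq_fset0 f0.
by rewrite big_seq_fset1 mcoeffUU.
Qed.

Lemma pure0 (F : fieldType) (V : lmodType F) (I : choiceType) (i : I) :
  pure (0 : V) i = 0.
Proof. exact: monalgU0. Qed.

Lemma scale_pure (F : fieldType) (V : lmodType F) (I : choiceType)
  (c : F) (u : V) (i : I) : c *: pure u i = pure (c *: u) i.
Proof.
apply/malgP => i'; rewrite [LHS]tensor_scaleE /pure !mcoeffU.
by case: eqP => _; rewrite ?mulr1n ?mulr0n ?scaler0.
Qed.

Lemma pure_eq0 (F : fieldType) (V : lmodType F) (I : choiceType)
  (u : V) (i : I) : (pure u i == 0) = (u == 0).
Proof. exact: monalgU_eq0. Qed.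

(** * Orders of poles of fields and of normal ordered products *)

Section Poles.
Variables (F : fieldType) (W : lmodType F).
Implicit Types (A B : superfield W) (x : W).

(** Modes are bare functions; this fragment of linearity lets an inner mode that vanishes kill a
    composite. *)
Definition preserves0 A := forall n, A n 0 = 0.

(** Mode n is the coefficient of z^{-n-1}, so this bounds by N the order of the pole of A(z)x at z =
    0; for N = 0 the series is regular. *)
Definition pole_le (N : int) A x := forall n : int, N <= n -> A n x = 0.

Lemma pole_leW (N N' : int) A x : N <= N' -> pole_le N A x -> pole_le N' A x.
Proof. by move=> NN' Ax n /(le_trans NN'); apply: Ax. Qed.

Lemma pole_le_at0 N A : preserves0 A -> pole_le N A 0.
Proof. by move=> A0 n _. Qed.

Lemma fderiv_preserves0 A : preserves0 A -> preserves0 (fderiv A).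
Proof. by move=> A0 n; rewrite /= A0 scaler0. Qed.

Lemma pole_fderiv N A x : pole_le N A x -> pole_le (N + 1) (fderiv A) x.
Proof. by move=> Ax n Nn; rewrite /= Ax ?scaler0//; lia. Qed.

(* The coefficient of z^{-1} in a derivative vanishes. *)
Lemma pole_fderiv0 A x : pole_le 0 A x -> pole_le 0 (fderiv A) x.
Proof.
move=> Ax n n0 /=; have [->|nN0] := eqVneq n 0; first by rewrite oppr0 scale0r.
by rewrite Ax ?scaler0//; lia.
Qed.

Lemma nop_preserves0 A B : preserves0 A -> preserves0 B -> preserves0 (A ** B).
Proof.
by move=> A0 B0 n; apply: fsbig1 => j _; rewrite !(A0, B0) scaler0 addr0.
Qed.

(** In mode N + d the terms A_{-j-1} B_{N+d+j} x vanish by the bound on B. Among the terms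
    B_{N+d-j-1} A_j x, those with j > d vanish by the bound on A, those with j < d by the bound on B
    at A_j x, which leaves j = d. *)
Lemma nop_leading A B x (N : int) (d : nat) :
    preserves0 A -> preserves0 B ->
    pole_le N B x -> pole_le d.+1 A x ->
    (forall j : nat, (j < d)%N -> pole_le N B (A j x)) ->
  (A ** B) (N + d%:Z) x = (-1) ^+ (fodd A && fodd B) *: B (N - 1) (A d x).
Proof.
move=> A0 B0 Bx Ax BAx; rewrite /= (fsbigTE [fset d]%fset) => [|j].
  by rewrite big_seq_fset1 (Bx _ _) ?A0 ?add0r; [congr (_ *: B _ _)|]; lia.
rewrite inE => jd; rewrite (Bx _ _) ?A0 ?add0r; last by lia.
have [lt_jd|le_dj] := ltnP j d; first by rewrite BAx ?scaler0//; lia.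
by rewrite Ax ?B0 ?scaler0//; lia.
Qed.

Lemma pole_nop A B x (N : int) (d : nat) :
    preserves0 A -> preserves0 B ->
    pole_le N B x -> pole_le d A x ->
    (forall j : nat, (j < d)%N -> pole_le N B (A j x)) ->
  pole_le (N + d%:Z) (A ** B) x.
Proof.
move=> A0 B0 Bx Ax BAx n Nn; apply: fsbig1 => j _.
rewrite (Bx _ _) ?A0 ?add0r; last by lia.
have [lt_jd|le_dj] := ltnP j d; first by rewrite BAx ?scaler0//; lia.
by rewrite Ax ?B0 ?scaler0//; lia.
Qed.

Lemma pole_nop0 A B x (N : int) :
    preserves0 A -> preserves0 B -> pole_le N B x -> pole_le 0 A x ->
  pole_le N (A ** B) x.
Proof.
by move=> A0 B0 Bx Ax; rewrite -[N]addr0; apply: (@pole_nop _ _ _ _ 0).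
Qed.

Lemma pole_nop1 A B x (N : int) :
    preserves0 A -> preserves0 B -> pole_le N B x -> pole_le 1 A x ->
    pole_le N B (A 0 x) ->
  pole_le (N + 1) (A ** B) x.
Proof.
by move=> A0 B0 Bx Ax BAx; apply: (@pole_nop _ _ _ _ 1) => // -[].
Qed.

Lemma scale_sub_eq0 (t : F) (y z : W) : y = 0 -> z = 0 -> t *: (y - z) = 0.
Proof. by move=> -> ->; rewrite subr0 scaler0. Qed.

Lemma scale_eq0_iff (t : F) (y : W) : y != 0 -> t *: y = 0 <-> t = 0.
Proof.
move=> y0; split=> [/eqP|->]; last exact: scale0r.
by rewrite scaler_eq0 (negPf y0) orbF => /eqP.
Qed.

(** * Exponentials of oscillators and vertex operators *)

Lemma pow_coef0 (X : nat -> W -> W) r n :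
  (forall j, X j 0 = 0) -> pow_coef X r n 0 = 0.
Proof.
move=> X0; elim: r n => [|r IHr] n /=; first by rewrite if_same.
by apply: big1 => j _; rewrite IHr X0.
Qed.

Lemma exp_coef0 (X : nat -> W -> W) n :
  (forall j, X j 0 = 0) -> exp_coef X n 0 = 0.
Proof. by move=> X0; apply: big1 => r _; rewrite pow_coef0 ?scaler0. Qed.

Lemma exp_coef_const (X : nat -> W -> W) x : exp_coef X 0 x = x.
Proof. by rewrite /exp_coef big_ord1 /= fact0 invr1 scale1r. Qed.

Lemma exp_coef_annihilated (X : nat -> W -> W) n x :
    (forall j, X j 0 = 0) -> (forall j, X j x = 0) -> (0 < n)%N ->
  exp_coef X n x = 0.
Proof.
move=> X0 Xx n0.
(* The condition r + m > 0 excludes only the constant term of the zeroth power, which is x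
   itself. *)
have pow_x r m : (r + m > 0)%N -> pow_coef X r m x = 0.
  elim: r m => [|r IHr] m /= rm; first by case: m rm.
  apply: big1 => j _; have [rmj|] := ltnP 0 (r + (m - j.+1)).
    by rewrite IHr.
  (* Here r = 0 and m = j + 1, so the inner coefficient is x, which X_j kills. *)
  by rewrite leqn0 addn_eq0 => /andP[/eqP-> /eqP->].
by apply: big1 => r _; rewrite pow_x ?scaler0//; lia.
Qed.

(* The shape of a vertex operator: S is the shift of the zero mode, X and Y
   are the creating and annihilating oscillators. *)
Definition exp_field (S : W -> W) (X Y : nat -> W -> W) : superfield W :=
  Superfield (fun n x =>
    \sum_(ij \in [set ij : nat * nat | ij.1%:Z - ij.2%:Z = - n - 1]%classic)
      S (exp_coef X ij.1 (exp_coef Y ij.2 x))) false.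

Section ExpField.
Variables (S : W -> W) (X Y : nat -> W -> W).
Hypotheses (S0 : S 0 = 0) (X0 : forall j, X j 0 = 0) (Y0 : forall j, Y j 0 = 0).

Lemma exp_field_preserves0 : preserves0 (exp_field S X Y).
Proof. by move=> n; apply: fsbig1 => ij _; rewrite !exp_coef0. Qed.

(** Mode n collects the pairs with i - j = -n - 1. For n >= 0 this forces j > 0, and a positive
    coefficient of the annihilating exponential kills x. *)
Lemma pole_exp_field x : (forall j, Y j x = 0) -> pole_le 0 (exp_field S X Y) x.
Proof.
move=> Yx n n0; apply: fsbig1 => -[i j] /= ij.
by rewrite (exp_coef_annihilated Y0 Yx) ?exp_coef0//; lia.
Qed.

(** Mode -1 is the constant term in z, so i = j, and only (0, 0) avoids a positive annihilating
    coefficient. *)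
Lemma exp_field_leading x :
  (forall j, Y j x = 0) -> exp_field S X Y (-1) x = S x.
Proof.
move=> Yx; rewrite /= (@fsbigE _ _ _ _ _ [:: (0%N, 0%N)]) //=.
- by rewrite big_mkcond big_seq1 mem_set //= !exp_coef_const.
- by move=> ij /=; rewrite inE => /eqP->.
move=> [i j] /= ij; rewrite inE xpair_eqE => ij0.
by rewrite (exp_coef_annihilated Y0 Yx) ?exp_coef0//; lia.
Qed.

End ExpField.

End Poles.

(* The part of the realization that determines the leading terms: e stands for
   e^{b(U-F)}, P for the states u (x) |e^{a(U-F)}> (x) |0>, and x for the one
   whose first factor is the highest-weight vector. *)
Record vacuum_fields (F : fieldType) (W : lmodType F)
    (T H G Q dF psi psib e : superfield W) (P : W -> Prop) (S : W -> W)
    (h l j : F) (x : W) : Prop := VacuumFields {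
  vf_preserves0 : [/\ preserves0 T, preserves0 H, preserves0 G & preserves0 Q];
  vf_preserves0' :
    [/\ preserves0 dF, preserves0 psi, preserves0 psib & preserves0 e];
  vf_even : [/\ fodd T = false, fodd H = false & fodd dF = false];
  vf_scale : forall t y, P y -> P (t *: y);
  vf_psi : forall y, P y -> pole_le 0 psi y;
  vf_psib : forall y, P y -> pole_le 0 psib y;
  vf_e : forall y, P y -> pole_le 0 e y;
  vf_e_leading : forall y, P y -> e (-1) y = S y;
  vf_shift : forall t y, P y -> S (t *: y) = t *: S y;
  vf_dF : forall y, P y -> pole_le 1 dF y;
  vf_dF0 : forall y, P y -> dF 0 y = j *: y;
  vf_x : P x;
  vf_H : forall t, pole_le 1 H (t *: x);
  vf_H0 : forall t, H 0 (t *: x) = (t * h) *: x;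
  vf_T : pole_le 2 T x;
  vf_T0 : P (T 0 x);
  vf_T1 : T 1 x = l *: x;
  vf_G : pole_le 1 G x;
  vf_G0 : P (G 0 x);
  vf_Q : pole_le 1 Q x;
  vf_Q0 : P (Q 0 x)
}.

(** * Polar parts of the currents on abstract vacuum states *)

Section VacuumFields.
Variables (F : fieldType) (W : lmodType F).
Variables (T H G Q dF psi psib e : superfield W) (P : W -> Prop) (S : W -> W).
Variables (h l j : F) (x : W).
Hypothesis D : vacuum_fields T H G Q dF psi psib e P S h l j x.

Let T0 : preserves0 T. Proof. by have [] := vf_preserves0 D. Qed.
Let H0 : preserves0 H. Proof. by have [] := vf_preserves0 D. Qed.
Let G0 : preserves0 G. Proof. by have [] := vf_preserves0 D. Qed.
Let Q0 : preserves0 Q. Proof. by have [] := vf_preserves0 D. Qed.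
Let dF0 : preserves0 dF. Proof. by have [] := vf_preserves0' D. Qed.
Let psi0 : preserves0 psi. Proof. by have [] := vf_preserves0' D. Qed.
Let psib0 : preserves0 psib. Proof. by have [] := vf_preserves0' D. Qed.
Let e0 : preserves0 e. Proof. by have [] := vf_preserves0' D. Qed.
Let Px : P x. Proof. exact: (vf_x D). Qed.
Let PZ t : P (t *: x). Proof. exact: (vf_scale D). Qed.
Let Hx : pole_le 1 H x. Proof. by rewrite -[x]scale1r; exact: (vf_H D 1). Qed.
Let H0x : H 0 x = h *: x.
Proof. by rewrite -[x in LHS]scale1r (vf_H0 D) mul1r. Qed.
Let psiP y : P y -> pole_le 0 psi y. Proof. exact: (vf_psi D). Qed.
Let psibP y : P y -> pole_le 0 psib y. Proof. exact: (vf_psib D). Qed.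
Let eP y : P y -> pole_le 0 e y. Proof. exact: (vf_e D). Qed.
Let dFP y : P y -> pole_le 1 dF y. Proof. exact: (vf_dF D). Qed.
Let dF_even : fodd dF = false. Proof. by have [] := vf_even D. Qed.
Let H_even : fodd H = false. Proof. by have [] := vf_even D. Qed.
Let T_even : fodd T = false. Proof. by have [] := vf_even D. Qed.

Hint Resolve nop_preserves0 fderiv_preserves0 T0 H0 G0 Q0 dF0 psi0 psib0 e0
  Px PZ Hx : core.
Hint Resolve psiP psibP eP dFP pole_fderiv0 : core.

Lemma pole_nop_e A y :
  preserves0 A -> P y -> pole_le 0 A y -> pole_le 0 (A ** e) y.
Proof. by move=> A0 Py Ay; apply: pole_nop0; auto. Qed.

Hint Resolve pole_nop_e : core.

Lemma pole_dF_e y : P y -> pole_le 1 (dF ** e) y.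
Proof.
move=> Py; apply: (@pole_nop1 _ _ _ _ _ 0); auto.
by rewrite (vf_dF0 D) //; apply: (vf_e D); exact: (vf_scale D).
Qed.

Lemma dF_e_leading y : P y -> (dF ** e) 0 y = j *: S y.
Proof.
move=> Py; rewrite (@nop_leading _ _ dF e y 0 0) //; auto.
by rewrite dF_even expr0 scale1r (vf_dF0 D)// sub0r (vf_e_leading D)
           ?(vf_shift D)//; exact: (vf_scale D).
Qed.

Hint Resolve pole_dF_e : core.

Lemma pole_H_nop B : preserves0 B -> (forall y, P y -> pole_le 0 B y) ->
  pole_le 1 (H ** B) x.
Proof.
move=> B0 BP; apply: (@pole_nop1 _ _ _ _ _ 0) => //; first exact: BP.
by rewrite H0x; exact: BP.
Qed.

(** Only G, dF and H may have a pole, at most a simple one, and each term contains at most one of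
    them. *)
Lemma pole_F1 n (c : F) : 1 <= n ->
  (G ** e) n x - (psib ** dF ** e) n x - (1 / 2) *: (H ** psib ** e) n x
    - c *: (fderiv psib ** e) n x = 0.
Proof.
move=> n1.
rewrite (@pole_nop1 _ _ G e x 0) //; last first.
- exact: (vf_e D (vf_G0 D)).
- exact: (vf_G D).
- exact: (vf_e D Px).
rewrite (@pole_nop0 _ _ psib (dF ** e) x 1) //; auto.
rewrite (@pole_H_nop (psib ** e)) //; auto.
rewrite (@pole_leW _ _ 0 1 (fderiv psib ** e)) //; auto.
by rewrite !scaler0 !subr0.
Qed.

Lemma pole_F2 n (c1 c2 : F) : 1 <= n ->
  c1 *: (Q ** e) n x + (psi ** dF ** e) n x - (1 / 2) *: (H ** psi ** e) n x
    + c2 *: (fderiv psi ** e) n x = 0.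
Proof.
move=> n1.
rewrite (@pole_nop1 _ _ Q e x 0) //; last first.
- exact: (vf_e D (vf_Q0 D)).
- exact: (vf_Q D).
- exact: (vf_e D Px).
rewrite (@pole_nop0 _ _ psi (dF ** e) x 1) //; auto.
rewrite (@pole_H_nop (psi ** e)) //; auto.
rewrite (@pole_leW _ _ 0 1 (fderiv psi ** e)) //; auto.
by rewrite !scaler0 subr0 !addr0.
Qed.

Lemma pole_psi_psib : pole_le 0 (psi ** psib) x.
Proof. by apply: pole_nop0; auto. Qed.

Lemma pole_Hp n : 1 <= n ->
  - (1 / 2) *: H n x + (1 / 2) *: (psi ** psib) n x = 0.
Proof.
move=> n1; rewrite Hx // pole_psi_psib; last by lia.
by rewrite !scaler0 addr0.
Qed.

Lemma Hp_zero_mode :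
  - (1 / 2) *: H 0 x + (1 / 2) *: (psi ** psib) 0 x = (- (1 / 2) * h) *: x.
Proof. by rewrite H0x pole_psi_psib // scaler0 addr0 scalerA. Qed.

(** This repeats [cF12] term by term, so that the two agree by conversion once [e] is the vertex
    operator of exponent -2/k. *)
Definition F12_current (k : F) (n : int) (y : W) : W :=
  - (dF ** dF ** e) n y
  - (k + 1) *: (fderiv dF ** e) n y
  + (k + 1) *: ((T ** e) n y + (1 / 2) *: (fderiv H ** e) n y)
  + (1 / 4) *: (H ** H ** e) n y
  + (G ** psi ** e) n y
  - ((k + 1) / 2) *: (Q ** psib ** e) n y
  + (1 / 2) *: (H ** psi ** psib ** e) n y
  + ((1 + 2 * k) / 4) *: (psi ** fderiv psib ** e) n y
  - ((1 + 2 * k) / 4) *: (fderiv psi ** psib ** e) n y.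

(** Each of the five discarded terms has at most one factor with a pole, a simple one coming from G,
    Q or H; the fermions and their derivatives are regular. *)
Lemma F12_polar_terms k n : 1 <= n ->
  F12_current k n x =
  - (dF ** dF ** e) n x
  - (k + 1) *: (fderiv dF ** e) n x
  + (k + 1) *: ((T ** e) n x + (1 / 2) *: (fderiv H ** e) n x)
  + (1 / 4) *: (H ** H ** e) n x.
Proof.
move=> n1; rewrite /F12_current.
rewrite (@pole_nop1 _ _ G (psi ** e) x 0) //; auto; last first.
(* [G 0 x] need not be a multiple of x, but it satisfies [P], so [psi] and [e] are still regular on
   it. *)
- by apply: pole_nop_e => //; [exact: (vf_G0 D)|exact: (vf_psi D (vf_G0 D))].
- exact: (vf_G D).
rewrite (@pole_nop1 _ _ Q (psib ** e) x 0) //; auto; last first.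
- by apply: pole_nop_e => //; [exact: (vf_Q0 D)|exact: (vf_psib D (vf_Q0 D))].
- exact: (vf_Q D).
rewrite (@pole_H_nop (psi ** psib ** e)) //; last first.
- by move=> y Py; apply: pole_nop0; auto.
- by auto.
rewrite (@pole_leW _ _ 0 1 (psi ** fderiv psib ** e)) //; last first.
  by apply: pole_nop0; auto.
rewrite (@pole_leW _ _ 0 1 (fderiv psi ** psib ** e)) //; last first.
  by apply: pole_nop0; auto.
by rewrite !scaler0 !subr0 !addr0.
Qed.

(** Differentiating t/z gives -t/z^2 and no 1/z term. This is the source of the terms linear in j
    and h in the leading coefficient. *)
Lemma fderiv_e A t : preserves0 A -> fodd A = false ->
    pole_le 1 A x -> A 0 x = t *: x ->
  pole_le 2 (fderiv A ** e) x /\ (fderiv A ** e) 1 x = - t *: S x.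
Proof.
move=> A0 A_even Ax A0x.
have dA0 : fderiv A 0 x = 0 by rewrite /= oppr0 scale0r.
have dA i : (i < 1)%N -> pole_le 0 e (fderiv A i x).
  by case: i => // _; rewrite dA0; exact: pole_le_at0.
have dAx : pole_le 2 (fderiv A) x by exact: (pole_fderiv Ax).
split.
  apply: (@pole_nop _ _ _ _ _ 0 2) => //; auto.
  case=> [|[|//]] _; first exact: dA.
  by rewrite /= A0x scalerA; auto.
rewrite (@nop_leading _ _ (fderiv A) e x 0 1) //; auto.
rewrite [fodd _]A_even expr0 scale1r sub0r.
have -> : fderiv A 1 x = - t *: x by rewrite /= subrr A0x scaleN1r scaleNr.
by rewrite (vf_e_leading D)// (vf_shift D).
Qed.

Lemma dF_dF_e :
  pole_le 2 (dF ** dF ** e) x /\ (dF ** dF ** e) 1 x = j ^+ 2 *: S x.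
Proof.
split.
  by apply: (@pole_nop1 _ _ _ _ _ 1) => //; auto; rewrite (vf_dF0 D) //; auto.
rewrite (@nop_leading _ _ dF (dF ** e) x 1 0) //; auto.
rewrite dF_even expr0 scale1r (vf_dF0 D)// subrr dF_e_leading // (vf_shift D)//.
by rewrite scalerA expr2.
Qed.

(** The multiple t is there because in HH the outer factor first turns x into h x. *)
Lemma H_e t :
  pole_le 1 (H ** e) (t *: x) /\ (H ** e) 0 (t *: x) = (t * h) *: S x.
Proof.
split.
  apply: (@pole_nop1 _ _ _ _ _ 0) => //; auto; first exact: (vf_H D).
  by rewrite (vf_H0 D); auto.
rewrite (@nop_leading _ _ H e (t *: x) 0 0) //; auto; last exact: (vf_H D).
by rewrite H_even expr0 scale1r (vf_H0 D) sub0r (vf_e_leading D)// (vf_shift D).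
Qed.

Lemma H_H_e :
  pole_le 2 (H ** H ** e) x /\ (H ** H ** e) 1 x = h ^+ 2 *: S x.
Proof.
have [HHx _] := H_e 1; rewrite scale1r in HHx.
split.
  by apply: (@pole_nop1 _ _ _ _ _ 1) => //; auto; rewrite H0x; case: (H_e h).
rewrite (@nop_leading _ _ H (H ** e) x 1 0) //; auto.
by rewrite H_even expr0 scale1r H0x subrr (H_e h).2 expr2.
Qed.

(** Because of the weight 2 of T, mode 1 is L_0 and gives l, while mode 0 is L_{-1}, which leaves
    the line of x but stays in [P]. *)
Lemma T_e : pole_le 2 (T ** e) x /\ (T ** e) 1 x = l *: S x.
Proof.
have TP i : (i < 1)%N -> pole_le 0 e (T i x).
  by case: i => // _; exact: (eP (vf_T0 D)).
split.
  apply: (@pole_nop _ _ _ _ _ 0 2) => //; auto; first exact: (vf_T D).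
  by case=> [|[|//]] _; [exact: (eP (vf_T0 D))|rewrite (vf_T1 D); auto].
rewrite (@nop_leading _ _ T e x 0 1) //; auto; last exact: (vf_T D).
by rewrite T_even expr0 scale1r (vf_T1 D) sub0r (vf_e_leading D)// (vf_shift D).
Qed.

Lemma pole_F12 k n : 2 <= n -> F12_current k n x = 0.
Proof.
move=> n2; rewrite F12_polar_terms; last by lia.
have [dFx _] := fderiv_e dF0 dF_even (dFP Px) (vf_dF0 D Px).
have [Hdx _] := fderiv_e H0 H_even Hx H0x.
rewrite dF_dF_e.1 // dFx // T_e.1 // Hdx // H_H_e.1 //.
by rewrite !(scaler0, oppr0, addr0).
Qed.

Lemma F12_leading k :
  F12_current k 1 x =
  (- j ^+ 2 + (k + 1) * j + (k + 1) * (l - 1 / 2 * h) + 1 / 4 * h ^+ 2) *: S x.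
Proof.
rewrite F12_polar_terms //.
have [_ dFx] := fderiv_e dF0 dF_even (dFP Px) (vf_dF0 D Px).
have [_ Hdx] := fderiv_e H0 H_even Hx H0x.
rewrite dF_dF_e.2 dFx T_e.2 Hdx H_H_e.2.
rewrite !scalerA -!scalerDl -!scaleNr -!scalerDl !scalerA -!scalerDl.
by congr (_ *: _); ring.
Qed.

End VacuumFields.

(** * The free-field realization on the states u (x) |e^{a(U-F)}> (x) |0> *)

Section VacuumStates.
Variables (F : fieldType) (k c : F) (V : lmodType F) (M : N2_module c V).

Notation W := (tensor V (fock_index F)).
Notation H := (fH M).
Notation G := (fG M).
Notation Q := (fQ M).
Notation T := (fT M).
Notation psi := (fpsi M).
Notation psib := (fpsib M).
Notation dF := (fdF k V).
Notation dU := (fdU k V).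
Notation e b := (vertex k V b).

Lemma on_first_preserves0 (A : V -> V) : on_first A (0 : W) = 0.
Proof. exact: tensor_ext0. Qed.

Lemma on_first_vacuum (A : {linear V -> V}) u (a : F) :
  on_first A (vacuum_state u a) = vacuum_state (A u) a.
Proof. by rewrite /on_first tensor_ext_pure // linear0 pure0. Qed.

Lemma psi_preserves0 : preserves0 psi.
Proof. by move=> n /=; rewrite /psi_mode; case: ifP => _; exact: tensor_ext0. Qed.

Lemma psib_preserves0 : preserves0 psib.
Proof.
by move=> n /=; rewrite /psib_mode; case: ifP => _; exact: tensor_ext0.
Qed.

Lemma fermi_annihilate_vacuum t u (a : F) :
  fermi_annihilate M t (vacuum_state u a) = 0.
Proof. by rewrite /fermi_annihilate tensor_ext_pure !inE. Qed.

(** Mode n of [psi] is psi_{n+1}, so n >= 0 meets exactly the annihilators psi_{>=1}. *)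
Lemma pole_psi u (a : F) : pole_le 0 psi (vacuum_state u a).
Proof.
by move=> n n0 /=; rewrite /psi_mode ifF ?fermi_annihilate_vacuum//; lia.
Qed.

Lemma pole_psib u (a : F) : pole_le 0 psib (vacuum_state u a).
Proof.
by move=> n n0 /=; rewrite /psib_mode ifF ?fermi_annihilate_vacuum//; lia.
Qed.

Lemma dF_vacuum (n : int) u (a : F) : 0 <= n ->
  dF n (vacuum_state u a) =
  vacuum_state (if n == 0 then (k * a / 2) *: u else 0) a.
Proof.
case: n => // -[|n] _ /=; rewrite /dF_mode tensor_ext_pure /=.
- by [].
- by rewrite scaler0 pure0.
- by rewrite onecmE muln0 mulr0 scale0r [RHS]pure0 pure0.
- by rewrite scaler0 pure0.
Qed.

Lemma dU_vacuum (n : int) u (a : F) : 0 <= n ->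
  dU n (vacuum_state u a) =
  vacuum_state (if n == 0 then (k * a / 2) *: u else 0) a.
Proof.
case: n => // -[|n] _ /=; rewrite /dU_mode tensor_ext_pure /=.
- by [].
- by rewrite scaler0 pure0.
- by rewrite onecmE muln0 mulr0 scale0r [RHS]pure0 pure0.
- by rewrite scaler0 pure0.
Qed.

Lemma dF_preserves0 : preserves0 dF.
Proof. by move=> n; exact: tensor_ext0. Qed.

Lemma dU_preserves0 : preserves0 dU.
Proof. by move=> n; exact: tensor_ext0. Qed.

Lemma pole_dF u (a : F) : pole_le 1 dF (vacuum_state u a).
Proof.
move=> n n1; rewrite dF_vacuum; last by lia.
by rewrite ifF ?[LHS]pure0//; lia.
Qed.

Lemma pole_dU u (a : F) : pole_le 1 dU (vacuum_state u a).
Proof.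
move=> n n1; rewrite dU_vacuum; last by lia.
by rewrite ifF ?[LHS]pure0//; lia.
Qed.

Lemma scale_vacuum (t : F) (u : V) (a : F) :
  t *: vacuum_state u a = vacuum_state (t *: u) a.
Proof. exact: scale_pure. Qed.

Lemma vacuum0 (a : F) : vacuum_state (0 : V) a = 0.
Proof. exact: pure0. Qed.

Lemma fock_shift_vacuum b (u : V) (a : F) :
  fock_shift b (vacuum_state u a) = vacuum_state u (a + b).
Proof. by rewrite /fock_shift tensor_ext_pure // pure0. Qed.

Lemma oscillator_preserves0 (t : F) n : t *: (dU n 0 - dF n 0) = 0.
Proof. exact: (scale_sub_eq0 _ (dU_preserves0 n) (dF_preserves0 n)). Qed.

Lemma oscillator_vacuum (t : F) n (u : V) (a : F) : 0 < n ->
  t *: (dU n (vacuum_state u a) - dF n (vacuum_state u a)) = 0.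
Proof.
by move=> n0; apply: scale_sub_eq0; [exact: pole_dU|exact: pole_dF].
Qed.

(** The two oscillator families inside [vertex] are named so that [vertexE] holds by conversion. *)
Definition creators (b : F) (j : nat) (x : W) : W :=
  (b / j.+1%:R) *: (dU (- j.+1%:Z) x - dF (- j.+1%:Z) x).

Definition annihilators (b : F) (j : nat) (x : W) : W :=
  - (b / j.+1%:R) *: (dU j.+1%:Z x - dF j.+1%:Z x).

Lemma creators0 b j : creators b j 0 = 0.
Proof. exact: oscillator_preserves0. Qed.

Lemma annihilators0 b j : annihilators b j 0 = 0.
Proof. exact: oscillator_preserves0. Qed.

Lemma annihilators_vacuum b j (u : V) (a : F) :
  annihilators b j (vacuum_state u a) = 0.
Proof. exact: oscillator_vacuum. Qed.

Lemma fock_shift0 (b : F) : fock_shift b (0 : W) = 0.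
Proof. exact: tensor_ext0. Qed.

Lemma vertexE b : e b = exp_field (fock_shift b) (creators b) (annihilators b).
Proof. by []. Qed.

Lemma vertex_preserves0 b : preserves0 (e b).
Proof.
rewrite vertexE.
exact: (exp_field_preserves0 (fock_shift0 b) (creators0 b) (annihilators0 b)).
Qed.

Lemma pole_vertex b (u : V) (a : F) : pole_le 0 (e b) (vacuum_state u a).
Proof.
rewrite vertexE; apply: (pole_exp_field (fock_shift0 b) (creators0 b)
  (annihilators0 b)) => j.
exact: annihilators_vacuum.
Qed.

Lemma vertex_leading b (u : V) (a : F) :
  e b (-1) (vacuum_state u a) = fock_shift b (vacuum_state u a).
Proof.
exact: (exp_field_leading (fock_shift0 b) (creators0 b) (annihilators0 b)
  (fun j => annihilators_vacuum b j u a)).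
Qed.

Lemma fock_shiftZ (b t : F) (u : V) (a : F) :
  fock_shift b (t *: vacuum_state u a) = t *: fock_shift b (vacuum_state u a).
Proof.
apply: (etrans (congr1 (fock_shift b) (scale_vacuum t u a))).
apply: (etrans (fock_shift_vacuum b (t *: u) a)).
apply: (etrans (esym (scale_vacuum t u (a + b)))).
exact: (congr1 (fun y : W => t *: y) (esym (fock_shift_vacuum b u a))).
Qed.

(** [P] allows every u in the first factor, since L_{-1}, G_{-1} and Q_0 move v out of its line; a
    stays fixed. *)
Lemma vacuum_state_fields (h l a b : F) (v : V) :
    (forall n : int, 1 <= n -> n2Q M n v = 0) ->
    (forall n : int, 0 <= n -> n2G M n v = 0) ->
    (forall n : int, 1 <= n -> n2L M n v = 0) ->
    (forall n : int, 1 <= n -> n2H M n v = 0) ->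
    n2H M 0 v = h *: v -> n2L M 0 v = l *: v ->
  vacuum_fields T H G Q dF psi psib (e b)
    (fun y => exists u, y = vacuum_state u a) (fock_shift b)
    h l (k * a / 2) (vacuum_state v a).
Proof.
move=> Qv Gv Lv Hv H0v L0v.
have vac0 (A : {linear V -> V}) : A v = 0 -> on_first A (vacuum_state v a) = 0.
  by move=> Av; rewrite on_first_vacuum Av vacuum0.
have vacP (A : {linear V -> V}) :
    exists u, on_first A (vacuum_state v a) = vacuum_state u a.
  by exists (A v); exact: on_first_vacuum.
constructor.
- by split=> n; exact: on_first_preserves0.
- split; [exact: dF_preserves0|exact: psi_preserves0|exact: psib_preserves0|].
  exact: vertex_preserves0.
- by [].
- by move=> t _ [u ->]; exists (t *: u); exact: scale_vacuum.
- by move=> _ [u ->]; exact: pole_psi.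
- by move=> _ [u ->]; exact: pole_psib.
- by move=> _ [u ->]; exact: pole_vertex.
- by move=> _ [u ->]; exact: vertex_leading.
- by move=> t _ [u ->]; exact: fock_shiftZ.
- by move=> _ [u ->]; exact: pole_dF.
- move=> _ [u ->]; exact: (etrans (@dF_vacuum 0 u a (lexx 0))
    (esym (scale_vacuum (k * a / 2) u a))).
- by exists v.
- move=> t n n1; apply: (etrans (congr1 (H n) (scale_vacuum t v a))).
  apply: (etrans (on_first_vacuum (n2H M n) _ _)).
  by rewrite linearZ /= Hv// scaler0 vacuum0.
- move=> t; apply: (etrans (congr1 (H 0) (scale_vacuum t v a))).
  apply: (etrans (on_first_vacuum (n2H M 0) _ _)).
  by rewrite linearZ /= H0v scalerA -scale_vacuum.
(* The modes of T and G are shifted by one: n >= 2 becomes L_{>=1} here, and n >= 1 becomes G_{>=0}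
   below. *)
- by move=> n n2; apply: vac0; apply: Lv; lia.
- exact: vacP.
- by apply: (etrans (on_first_vacuum (n2L M 0) _ _)); rewrite L0v -scale_vacuum.
- by move=> n n1; apply: vac0; apply: Gv; lia.
- exact: vacP.
- by move=> n n1; apply: vac0; apply: Qv; lia.
- exact: vacP.
Qed.

End VacuumStates.

(** * Nonvanishing of the highest-weight vector, and the equivalence *)

Lemma pbw_monomial1 (F : fieldType) (c : F) (V : lmodType F)
    (M : N2_module c V) (v : V) :
  pbw_monomial M v (onecm nat, onecm nat, fset0, fset0)%fset = v.
Proof.
have supp1 : finsupp (onecm nat) = fset0.
  by apply/fsetP => i; rewrite in_fset0 -cmE_neq0 onecmE eqxx.
have sort0 : sort leq (fset0 : {fset nat}) = [::].
  by apply: size0nil; rewrite size_sort cardfs0.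
by rewrite /pbw_monomial /even_word /odd_word supp1 sort0.
Qed.

(** If v were 0, the basis element of the empty monomial and 0 would have the same image under the
    injective PBW map. *)
Lemma N2_verma_neq0 (F : fieldType) (c : F) (V : lmodType F)
    (M : N2_module c V) (h l : F) (v : V) :
  N2_verma M h l v -> v != 0.
Proof.
move=> [_ _ _ _ /bij_inj inj]; apply/eqP => v0.
pose t : pbw_index := (onecm nat, onecm nat, fset0, fset0)%fset.
have /inj/eqP : \sum_(i <- msupp (<< t >> : {malg F[pbw_index]}))
      (<< t >> : {malg F[pbw_index]})@_i *: pbw_monomial M v i =
    \sum_(i <- msupp (0 : {malg F[pbw_index]}))
      (0 : {malg F[pbw_index]})@_i *: pbw_monomial M v i.
  rewrite msuppU oner_eq0 msupp0 big_seq_fset1 big_seq_fset0 pbw_monomial1 v0.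
  exact: scaler0.
by rewrite monalgU_eq0 oner_eq0.
Qed.

Theorem theorem4p8 (R : realType) (k p l a : R[i])
    (V : lmodType R[i]) (M : N2_module (- 3 - 6 * k) V) (v : V) :
  k != 0 -> k != -1 ->
  N2_verma M (k - 2 * p) l v ->
  let j := k * a / 2 in
  ramond_highest_weight (N2_sl21_currents k M) p j k (vacuum_state v a)
  <-> l = - ((j + p - k / 2) * (1 - j + k / 2 + p) / (1 + k)).
Proof.
move=> k0 k1 verma j.
have v0 := N2_verma_neq0 verma.
case: verma => [[Qv Gv Lv Hv] H0v L0v _ _].
have D b := vacuum_state_fields k a b Qv Gv Lv Hv H0v L0v.
set x := vacuum_state v a.
have kS : 1 + k != 0 by rewrite addrC addr_eq0.
pose s := - j ^+ 2 + (k + 1) * j + (k + 1) * (l - 1 / 2 * (k - 2 * p))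
          + 1 / 4 * (k - 2 * p) ^+ 2.
(* With m = p - k/2 one has h = -2m, so s = (1 + k) l + (m^2 - j^2) + (1 + k)(j + m), and j + m
   factors out of the last two terms. *)
have sE : s = (1 + k) * (l + (j + p - k / 2) * (1 - j + k / 2 + p) / (1 + k)).
  by rewrite /s; field.
(* The shift only changes a to a + b, leaving v in the first factor. *)
have Sx0 b : fock_shift b x != 0.
  by rewrite fock_shift_vacuum pure_eq0.
have F12_1 : cF12 (N2_sl21_currents k M) 1 x
    = s *: fock_shift (- (2 / k)) x := F12_leading (D _) k.
have F12_1_eq0 : cF12 (N2_sl21_currents k M) 1 x = 0 <->
    l = - ((j + p - k / 2) * (1 - j + k / 2 + p) / (1 + k)).
  apply: (iff_trans _ (iff_trans (scale_eq0_iff s (Sx0 (- (2 / k)))) _)).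
    by rewrite -F12_1.
  rewrite sE; split=> [/eqP|->]; last by rewrite addNr mulr0.
  by rewrite mulf_eq0 (negPf kS) /= addr_eq0 => /eqP.
apply: (iff_trans _ F12_1_eq0); split=> [[_ [_ _ F12] _ _ _]|F12].
  exact: F12.
(* The exponent 0 is an arbitrary choice: [P] does not depend on b. *)
have Px := vf_x (D 0).
split.
- split=> n n0.
  + exact: (pole_nop_e (D _) (psi_preserves0 M) Px (pole_psi M v a) n0).
  + exact: (pole_nop_e (D _) (psib_preserves0 M) Px (pole_psib M v a) n0).
  + exact: (vf_e (D _) Px n0).
- split=> n n1.
  + exact: (pole_F1 (D _) _ n1).
  + exact: (pole_F2 (D _) _ _ n1).
  + have [->|nN1] := eqVneq n 1; first exact: F12.
    by apply: (pole_F12 (D _) k); lia.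
- move=> n n1; split; first exact: (pole_Hp (D 0) n1).
  exact: pole_dU.
- have hE : - (1 / 2) * (k - 2 * p) = p - k / 2 by field.
  exact: (etrans (Hp_zero_mode (D 0)) (congr1 (fun t => t *: x) hE)).
- exact: (etrans (@dU_vacuum _ k V 0 v a (lexx 0)) (esym (scale_vacuum j v a))).
Qed.
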